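(* Let $g$ be a normalized arithmetic function and let $1\le m<n$ be integers. Let $A_{n,m}^{g,\mathrm{id}}$ be the coefficient of $x^m$ in $n!\,P_n^{g,\mathrm{id}}(x)$. Then $$A_{n,m}^{g,\mathrm{id}}=\sum_{\mu\vdash n-m}\mathcal{G}(\mu)\prod_{k=0}^{|\mu|+\ell(\mu)-1}(n-k)\sum_{\lambda\in\mathrm{Orb}(\mu)}\prod_{k=1}^{\ell(\lambda)}\Big(k+\sum_{i=1}^k\lambda_i\Big)^{-1}.$$
   Context: An arithmetic function is a map $f:\mathbb{N}=\{1,2,\dots\}\to\mathbb{C}$; it is normalized if $f(1)=1$; $\mathrm{id}(n)=n$. For a normalized arithmetic function $g$ define $P_0^{g,\mathrm{id}}(x):=1$ and, for $n\ge1$, $P_n^{g,\mathrm{id}}(x):=\frac{x}{n}\sum_{k=1}^n g(k)P_{n-k}^{g,\mathrm{id}}(x)$. Write $n!\,P_n^{g,\mathrm{id}}(x)=\sum_{m=0}^nA^{g,\mathrm{id}}_{n,m}x^m$. For a partition $\mu=(\mu_1,\dots,\mu_r)$ (non-increasing positive integers), $\ell(\mu)=r$, $|\mu|=\sum\mu_i$, $\mathcal{G}(\mu):=\prod_{k=1}^r g(\mu_k+1)$, and $\mu\vdash N$ means $|\mu|=N$. $\mathrm{Orb}(\mu)$ is the set of distinct compositions (ordered sequences of positive integers) obtained by permuting the parts of $\mu$. *)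

(* Defs.v *)
From mathcomp Require Import all_boot all_order all_algebra.
From mathcomp Require Import reals complex.

Set Implicit Arguments.
Unset Strict Implicit.
Unset Printing Implicit Defensive.

Import GRing.Theory.
Local Open Scope ring_scope.

(* An arithmetic function is encoded as a map nat -> R[i], R[i] being the field
   of complex numbers over R : realType; its value at 0 is junk and does not
   enter any of the definitions below. *)
Definition normalized (R : realType) (g : nat -> R[i]) : Prop := g 1%N = 1.

(* Prev g n is [:: P_n; P_(n-1); ...; P_0], so in the step to n = n'.+1 the
   entry s`_k.-1 is P_(n-k). *)
Fixpoint Prev (R : realType) (g : nat -> R[i]) (n : nat) : seq {poly R[i]} :=
  if n is n'.+1 then
    let s := Prev g n' in
    n%:R^-1 *: ('X * \sum_(1 <= k < n.+1) g k *: s`_k.-1) :: s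
  else [:: 1].

Definition Ppoly (R : realType) (g : nat -> R[i]) (n : nat) : {poly R[i]} :=
  head 0 (Prev g n).

Lemma Ppoly0 (R : realType) (g : nat -> R[i]) : Ppoly g 0 = 1.
Proof. by []. Qed.

Lemma nth_Prev (R : realType) (g : nat -> R[i]) (n k : nat) :
  (k <= n)%N -> (Prev g n)`_k = Ppoly g (n - k).
Proof.
elim: n k => [|n IHn] [|k] //= le_kn.
by rewrite IHn.
Qed.

Lemma Ppoly_rec (R : realType) (g : nat -> R[i]) (n : nat) : (0 < n)%N ->
  Ppoly g n = n%:R^-1 *: ('X * \sum_(1 <= k < n.+1) g k *: Ppoly g (n - k)).
Proof.
case: n => // n _; rewrite {1}/Ppoly /=; congr (_ *: (_ * _)).
rewrite !big_nat; apply: eq_bigr => -[|k] //= le_kn.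
by rewrite nth_Prev // subSS.
Qed.

Definition Acoef (R : realType) (g : nat -> R[i]) (n m : nat) : R[i] :=
  (n`!%:R *: Ppoly g n)`_m.

Definition is_partition (N : nat) (mu : seq nat) : bool :=
  [&& sorted geq mu, all (leq 1) mu & sumn mu == N].

(* A partition of N has at most N parts, each at most N, so it is listed among
   the sequences of length at most N over 'I_N.+1. *)
Definition partitions (N : nat) : seq (seq nat) :=
  [seq mu <- [seq map val (s : seq 'I_N.+1) | s : N.-bseq 'I_N.+1]
     | is_partition N mu].

Lemma partitions_uniq (N : nat) : uniq (partitions N).
Proof.
rewrite filter_uniq // map_inj_uniq ?enum_uniq // => s t.
by move/(inj_map val_inj)/val_inj.
Qed.

Lemma mem_partitions (N : nat) (mu : seq nat) :
  (mu \in partitions N) = is_partition N mu.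
Proof.
rewrite mem_filter; case: (boolP (is_partition N mu)) => //= /and3P[_ pos_mu].
move/eqP=> sum_mu; have le_size : (size mu <= N)%N.
  rewrite -sum_mu; elim: mu pos_mu {sum_mu} => //= a s IHs /andP[a0 /IHs le_s].
  by rewrite -add1n leq_add.
have le_part : all (fun a => a < N.+1)%N mu.
  rewrite -sum_mu; apply/allP => a; rewrite ltnS.
  elim: mu {pos_mu sum_mu le_size} => //= b s IHs.
  rewrite inE => /predU1P[->|/IHs le_a]; first exact: leq_addr.
  exact: leq_trans le_a (leq_addl _ _).
have mapK : map val (map (@inord N) mu) = mu.
  rewrite -map_comp -[RHS]map_id; apply/eq_in_map => a /(allP le_part) lt_a.
  exact: inordK.
have size_s : (size (map (@inord N) mu) <= N)%N by rewrite size_map.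
by apply/mapP; exists (Bseq size_s); rewrite ?mem_enum.
Qed.

Definition calG (R : realType) (g : nat -> R[i]) (mu : seq nat) : R[i] :=
  \prod_(a <- mu) g a.+1.

(* [permutations mu] lists each rearrangement of mu exactly once, whatever the
   repetitions in mu. *)
Definition Orb (mu : seq nat) : seq (seq nat) := permutations mu.

(* Main.v *)
(** Clearing denominators, the recurrence for the [P_n] becomes
    [A_(n+1,m+1) = sum_j g(j+1) * n^_j * A_(n-j,m)], with [n^_j] the falling
    factorial.  Summing over [Orb mu] and then over the partitions [mu] of
    [n-m] amounts to summing over all compositions of [n-m], and the right-hand
    side obeys the same recurrence: with [L] the sum of the [lambda_i + 1], we
    have [(n+1)^_L = n^_L + L * n^_(L-1)]; the first term gives [j = 0], and in
    the second one [L] cancels the last factor of the product of inverses, so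
    that removing the last part [j] of the composition gives the summand [j]. *)
Require Import Defs.
From mathcomp Require Import all_boot all_order all_algebra.
From mathcomp Require Import reals complex.
From mathcomp Require Import ring zify.

Set Implicit Arguments.
Unset Strict Implicit.
Unset Printing Implicit Defensive.

Import GRing.Theory.
Local Open Scope ring_scope.

(** Built as the union of the orbits, so that the double sum of the theorem is by definition a
    single sum over this list. *)
Definition compositions (N : nat) : seq (seq nat) :=
  [seq lam | mu <- partitions N, lam <- Orb mu].

Lemma mem_compositions (N : nat) (lam : seq nat) :
  (lam \in compositions N) = all (leq 1) lam && (sumn lam == N).
Proof.
apply/allpairsPdep/idP => [[mu [nu []]]|/andP[pos_lam sum_lam]].
  rewrite mem_partitions mem_permutations => /and3P[_ pos_mu sum_mu] mu_nu ->.
  by rewrite (perm_all _ mu_nu) pos_mu (perm_sumn mu_nu).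
exists (sort geq lam), lam; split => //; last first.
  by rewrite mem_permutations perm_sym perm_sort.
rewrite mem_partitions /is_partition sort_sorted; last first.
  by move=> a b; apply: leq_total.
by rewrite all_sort pos_lam (perm_sumn (permEl (perm_sort _ _))).
Qed.

(** Orbits of different partitions are disjoint: two non-increasing rearrangements of one sequence
    coincide. *)
Lemma compositions_uniq (N : nat) : uniq (compositions N).
Proof.
apply: allpairs_uniq_dep => [|mu _|]; first exact: partitions_uniq.
  exact: permutations_uniq.
move=> [mu lam] [mu' lam'] /allpairsPdep[a [b [a_part b_a [-> ->]]]].
move=> /allpairsPdep[a' [b' [a'_part b'_a' [-> ->]]]] /= eq_b.
rewrite -{b'}eq_b in b'_a' *; suff -> : a = a' by [].
move: a_part a'_part b_a b'_a'; rewrite !mem_partitions !mem_permutations.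
move=> /andP[a_sorted _] /andP[a'_sorted _] b_a b_a'.
apply: (sorted_eq (leT := geq)) a_sorted a'_sorted _.
- by move=> x y z /= le_xy le_zx; apply: leq_trans le_zx le_xy.
- by move=> x y; rewrite /= andbC => /anti_leq.
by rewrite (perm_trans _ b_a') // perm_sym.
Qed.

Lemma compositions0 : perm_eq (compositions 0) [:: [::]].
Proof.
apply: uniq_perm => [||lam]; rewrite ?compositions_uniq // mem_compositions.
by rewrite inE; case: lam => [|[|a] s] //=; rewrite andbF.
Qed.

Lemma compositions_rcons (N : nat) : (0 < N)%N ->
  perm_eq (compositions N)
    [seq rcons lam a | a <- iota 1 N, lam <- compositions (N - a)].
Proof.
move=> N_gt0; apply: uniq_perm; first exact: compositions_uniq.
  apply: allpairs_uniq_dep => [|a _|]; first exact: iota_uniq.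
    exact: compositions_uniq.
  by move=> [a l] [b l'] _ _ /= /rcons_inj[-> ->].
move=> lam; rewrite mem_compositions; apply/idP/allpairsPdep.
  case/lastP: lam => [|l a]; first by case: N N_gt0.
  rewrite all_rcons sumn_rcons => /andP[/andP[a_gt0 pos_l] /eqP sum_l].
  exists a, l; split=> //; last by rewrite mem_compositions pos_l -sum_l addnK /=.
  by rewrite mem_iota a_gt0 add1n ltnS -sum_l leq_addl.
move=> [a [l [+ + ->]]]; rewrite mem_iota mem_compositions add1n ltnS.
move=> /andP[a_gt0 le_aN] /andP[pos_l /eqP sum_l].
by rewrite all_rcons sumn_rcons a_gt0 pos_l sum_l subnK /=.
Qed.

(** The truncated [n - L] differs from the ring difference only when [n < L], and then [n ^_ L] is
    already zero. *)
Lemma natr_ffact (R : pzRingType) (n L : nat) :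
  (n ^_ L)%:R = \prod_(0 <= k < L) (n%:R - k%:R) :> R.
Proof.
elim: L => [|L IHL]; first by rewrite big_geq.
rewrite big_nat_recr //= -IHL ffactnSr natrM.
have [le_Ln|lt_nL] := leqP L n; first by rewrite natrB.
by rewrite ffact_small // !mul0r.
Qed.

Lemma ffactSS_pascal (n L : nat) :
  (n.+1 ^_ L.+1 = n ^_ L.+1 + L.+1 * n ^_ L)%N.
Proof.
rewrite ffactSS ffactnSr.
have [le_Ln|lt_nL] := leqP L n; last by rewrite ffact_small // !(muln0, mul0n).
by rewrite (mulnC L.+1) -mulnDr addnS subnK // mulnC.
Qed.

Lemma ffactnD (n a b : nat) : (n ^_ (a + b) = n ^_ a * (n - a) ^_ b)%N.
Proof.
elim: b => [|b IHb]; first by rewrite addn0 ffactn0 muln1.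
by rewrite addnS !ffactnSr IHb subnDA mulnA.
Qed.

(** Kept literally as in the theorem; it is the only factor of [comp_term] that depends on the order
    of the parts. *)
Definition orb_weight (R : realType) (lam : seq nat) : R[i] :=
  \prod_(1 <= k < (size lam).+1)
     (k%:R + \sum_(1 <= i < k.+1) (nth 0%N lam i.-1)%:R)^-1.

Definition comp_term (R : realType) (g : nat -> R[i]) (n : nat)
    (lam : seq nat) : R[i] :=
  calG g lam * (n ^_ (sumn lam + size lam))%:R * orb_weight R lam.

(** The partial sums for [k <= size lam] do not see the last part, so appending [a] only adds one
    factor. *)
Lemma orb_weight_rcons (R : realType) (lam : seq nat) (a : nat) :
  orb_weight R (rcons lam a)
  = orb_weight R lam * ((size lam).+1 + (sumn lam + a))%:R^-1.
Proof.
rewrite /orb_weight size_rcons big_nat_recr //=; congr (_ * _).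
  apply: eq_big_nat => k /andP[_ lt_k]; congr (_ + _)^-1.
  apply: eq_big_nat => i /andP[i_gt0 lt_i]; rewrite nth_rcons.
  by rewrite -ltnS prednK // (leq_trans lt_i lt_k).
rewrite natrD; congr (_ + _)^-1.
by rewrite big_add1 /= -natr_sum -sumn_rcons sumnE [in RHS](big_nth 0%N) size_rcons.
Qed.

Lemma comp_termS_rcons (R : realType) (g : nat -> R[i]) (n a : nat)
    (lam : seq nat) :
  comp_term g n.+1 (rcons lam a)
  = comp_term g n (rcons lam a) + g a.+1 * (n ^_ a)%:R * comp_term g (n - a) lam.
Proof.
rewrite /comp_term sumn_rcons size_rcons addnS ffactSS_pascal natrD mulrDr mulrDl.
congr (_ + _); rewrite orb_weight_rcons /calG big_rcons /=.
rewrite addSn (addnC (size lam)); set L := (_ + _ + _)%N.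
(* With [a] in front, [ffactnD] splits off [n ^_ a] and leaves the falling factorial of
   [comp_term g (n - a) lam]. *)
have -> : L = (a + (sumn lam + size lam))%N by rewrite /L addnAC addnC.
rewrite natrM ffactnD natrM.
have : (a + (sumn lam + size lam)).+1%:R != 0 :> R[i].
  by rewrite Num.Theory.pnatr_eq0.
move: (_.+1%:R) => S S_neq0.
by field; exact: S_neq0.
Qed.

Lemma sum_comp_termS (R : realType) (g : nat -> R[i]) (n N : nat) :
  \sum_(lam <- compositions N) comp_term g n.+1 lam
  = \sum_(lam <- compositions N) comp_term g n lam
    + \sum_(1 <= a < N.+1)
        g a.+1 * (n ^_ a)%:R
        * \sum_(lam <- compositions (N - a)) comp_term g (n - a) lam.
Proof.
have [->|N_gt0] := posnP N.
  (* The empty composition has no last part, and its term does not depend on [n]. *)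
  rewrite !(perm_big _ compositions0) !big_seq1 [X in _ + X]big_geq // addr0.
  by rewrite /comp_term !ffactn0.
rewrite !(perm_big _ (compositions_rcons N_gt0)) /= !big_allpairs_dep /=.
rewrite /index_iota subSS subn0 -big_split /=; apply: eq_bigr => a _.
rewrite mulr_sumr -big_split /=; apply: eq_bigr => lam _.
exact: comp_termS_rcons.
Qed.

(** The factor [1/(n+1)] turns [(n+1)!] into [n! = n ^_ j * (n-j)!], and [j = k - 1] shifts the
    index of the defining sum. *)
Lemma Acoef_rec (R : realType) (g : nat -> R[i]) (n m : nat) :
  Acoef g n.+1 m.+1
  = \sum_(0 <= j < n.+1) g j.+1 * (n ^_ j)%:R * Acoef g (n - j) m.
Proof.
rewrite /Acoef Ppoly_rec // !coefZ coefXM /= coef_sum mulrA factS natrM.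
rewrite [_ * _ / _]mulrAC divff ?Num.Theory.pnatr_eq0 // mul1r mulr_sumr big_add1 /=.
apply: eq_big_nat => j /andP[_ le_jn].
by rewrite !coefZ -(ffact_fact (le_jn : j <= n)%N) natrM subSS; ring.
Qed.

Lemma Acoef_n0 (R : realType) (g : nat -> R[i]) (n : nat) :
  (0 < n)%N -> Acoef g n 0 = 0.
Proof. by move=> n_gt0; rewrite /Acoef Ppoly_rec // !coefZ coefXM !mulr0. Qed.

Lemma Acoef_gt_degree (R : realType) (g : nat -> R[i]) (n m : nat) :
  (n < m)%N -> Acoef g n m = 0.
Proof.
elim: m n => // m IHm [_|n lt_nm]; first by rewrite /Acoef Ppoly0 coefZ coef1 mulr0.
rewrite Acoef_rec big_nat big1 // => j _.
by rewrite IHm ?mulr0 // (leq_ltn_trans (leq_subr _ _)).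
Qed.

Lemma Acoef_compositions (R : realType) (g : nat -> R[i]) (n m : nat) :
  normalized g -> (m <= n)%N ->
  Acoef g n m = \sum_(lam <- compositions (n - m)) comp_term g n lam.
Proof.
move=> g1; elim: m n => [|m IHm] [|n] // => [_|_|le_mn].
- rewrite subn0 (perm_big _ compositions0) big_seq1 /comp_term /orb_weight.
  by rewrite /Acoef Ppoly0 coefZ coef1 /calG big_nil big_geq // !mulr1.
(* A composition of [n+1] has at least one part, so its falling factorial has length above [n+1] and
   vanishes. *)
- rewrite Acoef_n0 // subn0 big_seq big1 // => lam.
  rewrite mem_compositions => /andP[_ /eqP sum_lam].
  rewrite /comp_term ffact_small ?mulr0 ?mul0r // sum_lam.
  by case: lam sum_lam => //= a s _; rewrite addnS leq_addr.
rewrite subSS sum_comp_termS -IHm // Acoef_rec.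
(* For [j > n - m] the coefficient index [m] exceeds the degree bound [n - j]. *)
rewrite (big_cat_nat (n := (n - m).+1)) //= ?ltnS ?leq_subr //.
rewrite [X in _ + X]big_nat [X in _ + X]big1 ?addr0 => [|j]; last first.
  case/andP=> lt_j le_jn; rewrite Acoef_gt_degree ?mulr0 //.
  by lia.
(* Normalization gives the summand [j = 0] the coefficient [g 1 = 1]. *)
rewrite big_ltn // g1 mul1r ffactn0 mul1r subn0; congr (_ + _).
apply: eq_big_nat => j /andP[_ lt_j].
by rewrite subnAC IHm //; lia.
Qed.

Theorem theorem2 (R : realType) (g : nat -> R[i]) (n m : nat) :
  normalized g -> (1 <= m)%N -> (m < n)%N ->
  Acoef g n m =
  \sum_(mu <- partitions (n - m))
     calG g mu
     * (\prod_(0 <= k < sumn mu + size mu) (n%:R - k%:R))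
     * (\sum_(lam <- Orb mu)
          \prod_(1 <= k < (size lam).+1)
             (k%:R + \sum_(1 <= i < k.+1) (nth 0%N lam i.-1)%:R)^-1).
Proof.
move=> g1 _ /ltnW le_mn; rewrite Acoef_compositions // big_allpairs_dep /=.
apply: eq_bigr => mu _; rewrite mulr_sumr -natr_ffact big_seq [RHS]big_seq.
apply: eq_bigr => lam; rewrite mem_permutations => lam_mu.
rewrite -/(orb_weight R lam) /comp_term /calG.
by rewrite (perm_big _ lam_mu) (perm_sumn lam_mu) (perm_size lam_mu).
Qed.
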